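(* Let $\mathbf{K}\mathsf{G}_{\mathsf{inv}}$ be the Gödel modal logic with involutive negation described in the context. 1. For every frame $\mathfrak{F}=\langle W,R\rangle$ with $R:W\times W\to[0,1]$: $\mathfrak{F}\models_{\mathbf{K}\mathsf{G}_{\mathsf{inv}}}\Box p\leftrightarrow{\sim_\mathsf{i}}\lozenge{\sim_\mathsf{i}} p$ if and only if $\mathfrak{F}$ is crisp (i.e., $R$ takes values only in $\{0,1\}$). 2. $\Box$ and $\lozenge$ are not interdefinable on fuzzy frames: there is no $\Box$-free formula $\chi$ of $\mathscr{L}_{{\sim_\mathsf{i}},\Box,\lozenge}$ such that $v(\chi,w)=v(\Box p,w)$ for every fuzzy model $\langle W,R,v\rangle$ and every $w\in W$, and there is no $\lozenge$-free formula $\psi$ such that $v(\psi,w)=v(\lozenge p,w)$ for every fuzzy model and every $w\in W$.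
   Context: Fix a countable set $\mathtt{Prop}$ of variables. The language $\mathscr{L}_{{\sim_\mathsf{i}},\Box,\lozenge}$ is given by $\phi::=p\mid{\sim_\mathsf{i}}\phi\mid(\phi\wedge\phi)\mid(\phi\to\phi)\mid\Box\phi\mid\lozenge\phi$ with $p\in\mathtt{Prop}$. A (fuzzy) frame is $\langle W,R\rangle$ with $W\neq\varnothing$ and $R:W\times W\to[0,1]$; it is crisp if $R$ takes values in $\{0,1\}$. A model is $\langle W,R,v\rangle$ with $v:\mathtt{Prop}\times W\to[0,1]$ extended by: $v({\sim_\mathsf{i}}\phi,w)=1-v(\phi,w)$; $v(\phi\wedge\chi,w)=\min(v(\phi,w),v(\chi,w))$; $v(\phi\to\chi,w)=1$ if $v(\phi,w)\le v(\chi,w)$ and $=v(\chi,w)$ otherwise; $v(\Box\phi,w)=\inf_{w'\in W}\{wRw'\to v(\phi,w')\}$ and $v(\lozenge\phi,w)=\sup_{w'\in W}\min(wRw',v(\phi,w'))$, where on $[0,1]$, $a\to b=1$ if $a\le b$ and $=b$ otherwise. $\phi\leftrightarrow\chi$ abbreviates $(\phi\to\chi)\wedge(\chi\to\phi)$. $\mathfrak{F}\models_{\mathbf{K}\mathsf{G}_{\mathsf{inv}}}\phi$ means $v(\phi,w)=1$ for every model on $\mathfrak{F}$ and every $w\in W$. *)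

(* Defs.v *)
(* World: MathComp with MathComp-Analysis; truth values are elements of [0, 1]
   in an arbitrary realType. *)
From mathcomp Require Import all_boot all_order all_algebra.
From mathcomp Require Import classical_sets reals.

Set Implicit Arguments.
Unset Strict Implicit.
Unset Printing Implicit Defensive.

Import Order.TTheory GRing.Theory Num.Theory.
Local Open Scope classical_set_scope.
Local Open Scope ring_scope.

Inductive formula (V : Type) : Type :=
  | Var of V
  | Inv of formula V
  | And of formula V & formula V
  | Imp of formula V & formula V
  | Box of formula V
  | Dia of formula V.

Definition Iff (V : Type) (phi chi : formula V) : formula V :=
  And (Imp phi chi) (Imp chi phi).

Fixpoint box_free (V : Type) (phi : formula V) : bool :=
  match phi with
  | Var _ => true
  | Inv a | Dia a => box_free a
  | And a b | Imp a b => box_free a && box_free b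
  | Box _ => false
  end.

Fixpoint dia_free (V : Type) (phi : formula V) : bool :=
  match phi with
  | Var _ => true
  | Inv a | Box a => dia_free a
  | And a b | Imp a b => dia_free a && dia_free b
  | Dia _ => false
  end.

Record frame (R : realType) : Type := Frame {
  world : Type;
  world_nonempty : inhabited world;
  acc : world -> world -> R;
  acc_itv : forall w w', 0 <= acc w w' <= 1
}.

Definition crisp (R : realType) (F : frame R) : Prop :=
  forall w w' : world F, acc w w' = 0 \/ acc w w' = 1.

(* A model on F is F together with a valuation. *)
Record valuation (R : realType) (V : Type) (F : frame R) : Type := Valuation {
  val_var : V -> world F -> R;
  val_var_itv : forall p w, 0 <= val_var p w <= 1
}.

Definition godel_imp (R : realType) (a b : R) : R := if a <= b then 1 else b.

(* Worlds are nonempty and all values lie in [0, 1], so [inf] and [sup] are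
   applied only to nonempty bounded sets, where they are the genuine bounds. *)
Fixpoint truth (R : realType) (V : Type) (F : frame R) (v : valuation V F)
    (phi : formula V) (w : world F) : R :=
  match phi with
  | Var p => val_var v p w
  | Inv a => 1 - truth v a w
  | And a b => Num.min (truth v a w) (truth v b w)
  | Imp a b => godel_imp (truth v a w) (truth v b w)
  | Box a => inf (range (fun w' => godel_imp (acc w w') (truth v a w')))
  | Dia a => sup (range (fun w' => Num.min (acc w w') (truth v a w')))
  end.

Definition valid_on (R : realType) (V : Type) (F : frame R)
    (phi : formula V) : Prop :=
  forall (v : valuation V F) (w : world F), truth v phi w = 1.

(* Main.v *)
Require Import Defs.
From mathcomp Require Import all_boot all_order all_algebra.
From mathcomp Require Import classical_sets reals.
From mathcomp Require Import lra.

(** If [R w w' = r] with [0 < r < 1], give [p] the value [R w x] at every [x]: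
    then [Box p] is 1 at [w], while [Dia (Inv p)] is at least [min r (1 - r)].

    For non-definability, each connective left in the fragment preserves a small
    set of value profiles. For [Box p], take worlds 1, 2 with [p] equal to 1/5
    and 2/5, both reflexive with degree 1, [R 2 1 = 1/2] and [R 1 2 = 0]. The profiles
    (0, 0), (1, 1), (1/5, 2/5), (4/5, 3/5) are closed under the Gödel
    connectives and fixed by [Dia], but [Box p] is 1/5 at world 2. For [Dia p],
    take one world with [R = 1/4] and [p = 1/2]: values in {0, 1/2, 1} are
    preserved by [Box], while [Dia p] is 1/4. *)

Set Implicit Arguments.
Unset Strict Implicit.
Unset Printing Implicit Defensive.

Import Order.TTheory GRing.Theory Num.Theory.
Local Open Scope classical_set_scope.
Local Open Scope ring_scope.

Lemma sup_max (R : realType) (A : set R) (x : R) :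
  A x -> ubound A x -> sup A = x.
Proof.
move=> Ax ubx; apply/eqP; rewrite eq_le; apply/andP; split.
- by apply: ge_sup => //; exists x.
- by apply: ub_le_sup => //; exists x.
Qed.

Lemma inf_min (R : realType) (A : set R) (x : R) :
  A x -> lbound A x -> inf A = x.
Proof.
move=> Ax lbx; apply/eqP; rewrite eq_le; apply/andP; split.
- by apply: ge_inf => //; exists x.
- by apply: lb_le_inf => //; exists x.
Qed.

Lemma godel_imp_ge0 (R : realType) (a b : R) : 0 <= b -> 0 <= godel_imp a b.
Proof. by rewrite /godel_imp; case: ifP. Qed.

Lemma truth_box_le (R : realType) (V : Type) (F : frame R) (v : valuation V F)
    (q : V) (w w' : world F) :
  truth v (Box (Var q)) w <= godel_imp (acc w w') (val_var v q w').
Proof.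
apply: ge_inf; last by exists w'.
exists 0 => _ [x _ <-]; apply: godel_imp_ge0.
by have /andP[] := val_var_itv v q x.
Qed.

Lemma truth_dia_ge (R : realType) (V : Type) (F : frame R) (v : valuation V F)
    (phi : formula V) (w w' : world F) :
  Num.min (acc w w') (truth v phi w') <= truth v (Dia phi) w.
Proof.
apply: ub_le_sup; last by exists w'.
exists 1 => _ [x _ <-]; rewrite ge_min.
by have /andP[_ ->] := acc_itv w x.
Qed.

Lemma crisp_box_dia (R : realType) (V : Type) (F : frame R)
    (v : valuation V F) (q : V) (w : world F) :
  crisp F ->
  truth v (Box (Var q)) w = truth v (Inv (Dia (Inv (Var q)))) w.
Proof.
move=> cF.
have E x : godel_imp (acc w x) (val_var v q x)
           = 1 - Num.min (acc w x) (1 - val_var v q x).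
  have /andP[a0 a1] := val_var_itv v q x.
  rewrite /godel_imp minEle.
  by case: (cF w x) => ->; do 2 case: leP => ?; lra.
apply/eqP; rewrite eq_le; apply/andP; split.
- rewrite /= lerBrDr addrC -lerBrDr.
  apply: ge_sup; first by exists (Num.min (acc w w) (1 - val_var v q w)), w.
  move=> _ [x _ <-]; have := truth_box_le v q w x; rewrite E /=; lra.
- apply: lb_le_inf; first by exists (godel_imp (acc w w) (val_var v q w)), w.
  move=> _ [x _ <-]; have := truth_dia_ge v (Inv (Var q)) w x.
  by rewrite /= E; lra.
Qed.

Lemma box_dia_crisp (R : realType) (V : Type) (F : frame R) (q : V) :
  valid_on F (Iff (Box (Var q)) (Inv (Dia (Inv (Var q))))) -> crisp F.
Proof.
move=> valF w w'.
pose v : valuation V F := Valuation (fun (_ : V) x => acc_itv w x).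
have box1 : truth v (Box (Var q)) w = 1.
  apply: inf_min; first by exists w => //; rewrite /godel_imp /= lexx.
  by move=> _ [x _ <-]; rewrite /godel_imp /= lexx.
have : 1 <= godel_imp (truth v (Box (Var q)) w)
                      (1 - truth v (Dia (Inv (Var q))) w).
  by rewrite -[X in X <= _](valF v w) ge_min lexx.
rewrite box1.
have := truth_dia_ge v (Inv (Var q)) w w'.
have /andP[r0 r1] := acc_itv w w'.
rewrite [truth v (Inv _) _]/=; move: (truth v (Dia _) w) => d.
rewrite /godel_imp minEle.
by case: (leP (acc w w') (1 - acc w w')) => ?; case: (leP 1 (1 - d)) => ? ? ?;
  (left; lra) || (right; lra).
Qed.

Section BoxNotDefinable.
Variables (R : realType) (V : Type).

Definition two_acc (w w' : bool) : R :=
  if w then if w' then 1 else 2^-1 else if w' then 0 else 1.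

Lemma two_acc_itv w w' : 0 <= two_acc w w' <= 1.
Proof. by case: w w' => [] []; rewrite /two_acc; lra. Qed.

Definition two_frame : frame R := Frame (inhabits true) two_acc_itv.

Definition two_val (w : bool) : R := if w then 2 / 5 else 1 / 5.

Lemma two_val_itv (q : V) w : 0 <= two_val w <= 1.
Proof. by case: w; rewrite /two_val; lra. Qed.

Definition two_model : valuation V two_frame :=
  @Valuation R V two_frame (fun=> two_val) two_val_itv.

Definition two_profile (f : bool -> R) : Prop :=
  [\/ f false = 0 /\ f true = 0, f false = 1 /\ f true = 1,
      f false = 1 / 5 /\ f true = 2 / 5 | f false = 4 / 5 /\ f true = 3 / 5].

Lemma two_profile_dia (f : bool -> R) (w : bool) : two_profile f ->
  sup (range (fun w' => Num.min (two_acc w w') (f w'))) = f w.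
Proof.
move=> Pf; apply: sup_max.
- exists w => //; rewrite minEle.
  by case: w Pf => -[] [e1 e2] /=; rewrite ?e1 ?e2; case: leP => ?; lra.
- move=> _ [w' _ <-]; rewrite minEle; case: (leP (two_acc w w') (f w')).
    by case: w w' Pf => [] [] -[] [e1 e2] /=; rewrite ?e1 ?e2; lra.
  by case: w w' Pf => [] [] -[] [e1 e2] /=; rewrite ?e1 ?e2; lra.
Qed.

Lemma two_profile_eq (f g : bool -> R) : f =1 g -> two_profile g ->
  two_profile f.
Proof. by rewrite /two_profile => fg; rewrite !fg. Qed.

Lemma two_profile_total (f g : bool -> R) : two_profile f -> two_profile g ->
  (forall w, f w <= g w) \/ (forall w, g w < f w).
Proof.
by move=> [] [f1 f2] [] [g1 g2];
  (left=> -[]; rewrite ?f1 ?f2 ?g1 ?g2; lra) ||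
  (right=> -[]; rewrite ?f1 ?f2 ?g1 ?g2; lra).
Qed.

Lemma box_free_profile (phi : formula V) : box_free phi ->
  two_profile (truth two_model phi).
Proof.
elim: phi => [q|a IHa|a IHa b IHb|a IHa b IHb|a _|a IHa] //=.
- by move=> _; apply: Or43.
- move=> /IHa [] [e1 e2]; rewrite /two_profile e1 e2;
  [apply: Or42|apply: Or41|apply: Or44|apply: Or43]; split; lra.
- move=> /andP[/IHa Pa /IHb Pb]; have [le_ab|lt_ba] := two_profile_total Pa Pb.
  + by apply: two_profile_eq Pa => w; rewrite /= min_l.
  + by apply: two_profile_eq Pb => w; rewrite /= min_r // ltW.
- move=> /andP[/IHa Pa /IHb Pb]; have [le_ab|lt_ba] := two_profile_total Pa Pb.
  + by apply: Or42; rewrite /godel_imp !le_ab.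
  + by apply: two_profile_eq Pb => w; rewrite /= /godel_imp leNgt lt_ba.
- move=> /IHa Pa; apply: two_profile_eq (Pa) => w.
  exact: two_profile_dia.
Qed.

Lemma two_model_box (q : V) : truth two_model (Box (Var q)) true = 1 / 5.
Proof.
apply: inf_min.
- by exists false => //; rewrite /godel_imp /=; case: leP => ?; lra.
- by move=> _ [w _ <-]; rewrite /godel_imp; case: ifP; case: w => /=; lra.
Qed.

End BoxNotDefinable.

Section DiaNotDefinable.
Variables (R : realType) (V : Type).

Lemma quarter_itv (w w' : unit) : 0 <= (4^-1 : R) <= 1.
Proof. by lra. Qed.

Lemma half_itv (q : V) (w : unit) : 0 <= (2^-1 : R) <= 1.
Proof. by lra. Qed.

Definition one_frame : frame R := Frame (inhabits tt) quarter_itv.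

Definition one_model : valuation V one_frame :=
  @Valuation R V one_frame (fun _ _ => 2^-1) half_itv.

Lemma dia_free_values (phi : formula V) : dia_free phi ->
  [\/ truth one_model phi tt = 0, truth one_model phi tt = 2^-1
    | truth one_model phi tt = 1].
Proof.
elim: phi => [q|a IHa|a IHa b IHb|a IHa b IHb|a IHa|a _] //=.
- by move=> _; apply: Or32.
- move=> /IHa [] ->; [apply: Or33|apply: Or32|apply: Or31]; lra.
- move=> /andP[/IHa Pa /IHb Pb]; rewrite minEle; case: ifP => _ //.
- move=> /andP[_ /IHb Pb]; rewrite /godel_imp; case: ifP => _ //.
  exact: Or33.
- move=> /IHa Pa.
  rewrite (@inf_min R _ (godel_imp 4^-1 (truth one_model a tt))).
  + by rewrite /godel_imp; case: ifP => _ //; apply: Or33.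
  + by exists tt.
  + by move=> _ [[] _ <-].
Qed.

Lemma one_model_dia (q : V) : truth one_model (Dia (Var q)) tt = 4^-1.
Proof.
apply: sup_max.
- by exists tt => //=; rewrite minEle; case: leP => ?; lra.
- by move=> _ [w _ <-]; rewrite minEle; case: ifP => /=; lra.
Qed.

End DiaNotDefinable.

Theorem theorem1 (R : realType) (V : countType) (p : V) :
  (forall F : frame R,
     valid_on F (Iff (Box (Var p)) (Inv (Dia (Inv (Var p))))) <-> crisp F)
  /\
  (~ exists chi : formula V,
       box_free chi /\
       forall (F : frame R) (v : valuation V F) (w : world F),
         truth v chi w = truth v (Box (Var p)) w)
  /\
  (~ exists psi : formula V,
       dia_free psi /\
       forall (F : frame R) (v : valuation V F) (w : world F),
         truth v psi w = truth v (Dia (Var p)) w).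
Proof.
split; [|split].
- move=> F; split; first exact: box_dia_crisp.
  move=> cF v w; have := crisp_box_dia v p w cF.
  rewrite /Iff; move: (Box _) (Inv _) => phi chi /= ->.
  by rewrite /godel_imp lexx minxx.
- move=> [chi [/(box_free_profile R) Pchi /(_ _ (two_model R V) true)]].
  by rewrite two_model_box; case: Pchi => -[_ ->]; lra.
- move=> [psi [/(dia_free_values R) Ppsi /(_ _ (one_model R V) tt)]].
  by rewrite one_model_dia; case: Ppsi => ->; lra.
Qed.
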